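(* Let $K$ be a virtual knot. If $\overline{zh}_J(K)=0$ for all sequences $J$ in $\{1,2\}$, then the generalized Alexander polynomial of $K$ is trivial (that is, zero).
   Context: Virtual knots. A virtual knot diagram is an oriented generically immersed closed curve in the plane whose double points are marked as classical (over/under) or virtual crossings. Virtual knots are diagrams modulo planar isotopy, Reidemeister moves and the detour move (an arc containing only virtual crossings may be replaced by any generic arc with the same endpoints all of whose crossings are virtual). Extended group. The short arcs of a diagram $K$ are the paths along $K$ from one classical crossing to the next (virtual crossings are ignored). Write them, in order along $K$ from a base point, as $a_{1},\dots,a_{n}$, indices modulo $n$. The extended group $\widetilde G(K)$ is generated by the short arcs and one further generator $v$, with relations $a_{j+1}=w_j^{-1}a_jw_j$ ($1\le j\le n$), where $w_j=v^{-1}$ if $K$ passes from $a_j$ to $a_{j+1}$ over a positive crossing, $w_j=v$ if over a negative crossing, $w_j=v\,o$ if under a positive crossing, and $w_j=(o\,v)^{-1}$ if under a negative crossing; here $o$ is the short arc of the overcrossing strand entering that crossing. (If there are no classical crossings there is one short arc and no relation.) This group is isomorphic to the group of the 2-component link $Zh(K)=K\cup\omega$, obtained by drawing at each classical crossing of $K$ an oriented arc passing over both strands and joining these arcs into one component $\omega$ using only virtual crossings; $v$ is a meridian of $\omega$. Extended longitude. Put $l_j=w_1\cdots w_j$ and $\widetilde\lambda=l_n a_1^{k}$, where $k$ is chosen so that the total exponent sum in $\widetilde\lambda$ of the letters $a_1,\dots,a_n$ is $0$ ($\widetilde\lambda=1$ if there are no classical crossings). Let $F$ be the free group on $a,v$.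 Define homomorphisms $\phi^{(q)}$, $q\ge1$, from the free group on $a_1,\dots,a_n,v$ to $F$ by $\phi^{(q)}(v)=v$, $\phi^{(1)}(a_j)=a$, $\phi^{(q)}(a_1)=a$, and $\phi^{(q+1)}(a_{j+1})=\phi^{(q)}(l_j)^{-1}\,a\,\phi^{(q)}(l_j)$ for $1\le j\le n-1$. Put $\widetilde\lambda^{(q)}=\phi^{(q)}(\widetilde\lambda)$. Invariants. The Magnus expansion $\epsilon:F\to\mathbb Z[[a,v]]$ (non-commuting power series) is given by $a\mapsto1+a$, $v\mapsto1+v$. For a nonempty sequence $J=j_1\cdots j_s$ in $\{1,2\}$, $\epsilon_J(f)$ is the coefficient in $\epsilon(f)$ of the monomial obtained from $J$ by replacing $1$ by $a$ and $2$ by $v$. For any $q>s$ set $\mu_{J|1}=\epsilon_J(\widetilde\lambda^{(q)})$ (independent of $q>s$) and $\mu_{J|2}=0$, where $J|i$ means $J$ followed by $i$. Let $\Delta_{J|1}$ be the greatest common divisor of all $\mu_{I}$ where $I$ ranges over sequences of length at least 2 obtained from $J|1$ by deleting one or more terms and cyclically permuting the remaining ones (with $\Delta=0$ if there are none or all are $0$). Then $\overline{zh}_J(K)$ is the residue class of $\mu_{J|1}$ modulo $\Delta_{J|1}$. Generalized Alexander polynomial. Take the presentation of $\widetilde G(K)$ with generators $a_1,\dots,a_n,v$ and relations $a_{j+1}=w_j^{-1}a_jw_j$ ($1\le j\le n$, indices modulo $n$; if there are no classical crossings, the generators are $a_1,v$ and there are no relations), and let $c=n+1$ be its number of generators. Form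 its Alexander matrix: the Jacobian of Fox derivatives of the relators with respect to the generators, mapped to $\mathbb Z[t^{\pm1},v^{\pm1}]$ by sending every short-arc generator to $t$ and $v$ to $v$. The elementary ideal $\mathscr E_1$ is generated by the $(c-1)\times(c-1)$ minors ($\mathscr E_1=0$ if there are fewer than $c-1$ rows). The greatest common divisor of these minors is the multi-variable Alexander polynomial of $Zh(K)$; the generalized Alexander polynomial of $K$ and this polynomial may be obtained from one another by a change of variables. In particular one is zero if and only if the other is. *)

(* Defs.v *)
From HB Require Import structures.
From mathcomp Require Import all_boot all_order all_algebra.
From mathcomp Require Import reals topology normedtype derive.
Set Implicit Arguments.
Unset Strict Implicit.
Unset Printing Implicit Defensive.
Import Order.TTheory GRing.Theory Num.Theory.
Import numFieldNormedType.Exports.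
Local Open Scope ring_scope.

(** * Virtual knot diagrams *)

Variant marking := Over | Under | Virtual.

Definition is_over (m : marking) := if m is Over then true else false.
Definition is_virtual (m : marking) := if m is Virtual then true else false.
Definition opposite (m : marking) :=
  match m with Over => Under | Under => Over | Virtual => Virtual end.

Definition cross (R : realType) (x y : R * R) : R := x.1 * y.2 - x.2 * y.1.

(* A closed curve is a 1-periodic map on the line, oriented by increasing
   parameter and based at parameter 0.  Every double point is passed at two
   parameters of [0, 1[; [crossings] lists all of these parameters in order.
   [mark t] says how the strand through t runs at the double point
   [curve t]; its value at other parameters is irrelevant. *)
Record vknot_diagram (R : realType) := VKnotDiagram {
  curve : R -> R * R;
  curve_periodic : forall t, curve (t + 1) = curve t;
  curve_derivable : forall t : R, derivable curve t 1;
  curve_C1 : continuous (derive1 curve);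
  curve_immersed : forall t, derive1 curve t <> 0;
  crossings : seq R;
  crossings_sorted : sorted <%R crossings;
  crossingsP : forall t, t \in crossings <->
    0 <= t < 1 /\ exists s, [/\ 0 <= s < 1, s <> t & curve s = curve t];
  crossings_double : forall s t u,
    s \in crossings -> t \in crossings -> u \in crossings ->
    curve s = curve t -> curve t = curve u -> [\/ s = t, t = u | s = u];
  crossings_transverse : forall s t, s \in crossings -> t \in crossings ->
    s <> t -> curve s = curve t -> cross (derive1 curve s) (derive1 curve t) <> 0;
  mark : R -> marking;
  mark_opposite : forall s t, s \in crossings -> t \in crossings ->
    s <> t -> curve s = curve t -> mark t = opposite (mark s)
}.

Definition classical_crossings (R : realType) (D : vknot_diagram R) : seq R :=
  [seq t <- crossings D | ~~ is_virtual (mark D t)].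

(* The number n of passages of the curve through classical crossings. *)
Definition npass (R : realType) (D : vknot_diagram R) : nat :=
  size (classical_crossings D).

Definition pass (R : realType) (D : vknot_diagram R) (i : nat) : R :=
  (classical_crossings D)`_i.

Definition partner (R : realType) (D : vknot_diagram R) (i : nat) : nat :=
  find (fun s => (s != pass D i) && (curve D s == curve D (pass D i)))
       (classical_crossings D).

(* At a positive crossing the tangent of the overcrossing strand followed by
   that of the undercrossing strand is a positively oriented basis. *)
Definition positive_pass (R : realType) (D : vknot_diagram R) (i : nat) : bool :=
  let di := derive1 (curve D) (pass D i) in
  let dp := derive1 (curve D) (pass D (partner D i)) in
  0 < (if is_over (mark D (pass D i)) then cross di dp else cross dp di).

(** * Words in a free group *)

(* An element of the free group on [I] is represented by a word, the letter
   [(x, false)] being the generator x and [(x, true)] its inverse.  Words are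
   not reduced; everything computed from words below is unchanged under
   insertion and deletion of x x^-1 and x^-1 x. *)
Definition word (I : Type) := seq (I * bool).

Definition wgen (I : Type) (x : I) : word I := [:: (x, false)].

Definition winv (I : Type) (u : word I) : word I :=
  rev [seq (l.1, ~~ l.2) | l <- u].

Definition wexp (I : Type) (x : I) (k : int) : word I :=
  nseq `|k|%N (x, k < 0).

(* The homomorphism of free groups sending each generator x to [h x]. *)
Definition wsubst (I J : Type) (h : I -> word J) (u : word I) : word J :=
  flatten [seq if l.2 then winv (h l.1) else h l.1 | l <- u].

(** * The extended group *)

(* The number of short arcs: n, or 1 if n = 0. *)
Definition narcs (n : nat) : nat := n.-1.+1.

(* [None] is v and [Some j] is the short arc a_{j+1}: arcs are numbered from 0,
   and the arc number j is the one entering the passage number j. *)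
Definition gen (n : nat) := option 'I_(narcs n).

Definition arc (n : nat) (j : nat) : gen n := Some (inord j).
Definition vgen (n : nat) : gen n := None.

Definition conjugator (R : realType) (D : vknot_diagram R) (i : nat) :
    word (gen (npass D)) :=
  let v := wgen (vgen (npass D)) in
  let o := wgen (arc (npass D) (partner D i)) in
  match is_over (mark D (pass D i)), positive_pass D i with
  | true, true => winv v
  | true, false => v
  | false, true => v ++ o
  | false, false => winv (o ++ v)
  end.

(* Relator of the relation a_{i+1} = w_i^-1 a_i w_i, arcs being indexed
   modulo n. *)
Definition relator (R : realType) (D : vknot_diagram R) (i : 'I_(npass D)) :
    word (gen (npass D)) :=
  winv (conjugator D i) ++ wgen (arc (npass D) i) ++ conjugator D i
  ++ winv (wgen (arc (npass D) (i.+1 %% npass D))).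
Arguments relator {R} D i.

(** * The extended longitude *)

(* The product l_j of the conjugators at the first j passages. *)
Definition partial_longitude (R : realType) (D : vknot_diagram R) (j : nat) :
    word (gen (npass D)) :=
  flatten (mkseq (conjugator D) j).

Definition arc_exponent (n : nat) (u : word (gen n)) : int :=
  \sum_(l <- u | isSome l.1) (-1) ^+ l.2.

Definition longitude (R : realType) (D : vknot_diagram R) :
    word (gen (npass D)) :=
  let l := partial_longitude D (npass D) in
  l ++ wexp (arc (npass D) 0) (- arc_exponent l).

(* The free group F on a and v: [false] is a and [true] is v. *)
Definition fa : word bool := wgen false.
Definition fv : word bool := wgen true.

(* The images of the generators under phi^(q), q >= 1; the value at q = 0 is a
   dummy.  As l_0 is empty, the last clause covers a_1 as well. *)
Fixpoint phi_gen (R : realType) (D : vknot_diagram R) (q : nat)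
    (x : gen (npass D)) {struct q} : word bool :=
  match x, q with
  | None, _ => fv
  | Some _, 0%N | Some _, 1%N => fa
  | Some j, (_.+1 as q').+1 =>
    let l := wsubst (phi_gen q') (partial_longitude D j) in
    winv l ++ fa ++ l
  end.
Arguments phi_gen {R} D q x.

Definition longitude_at (R : realType) (D : vknot_diagram R) (q : nat) :
    word bool :=
  wsubst (phi_gen D q) (longitude D).

(** * Magnus expansion *)

(* A non-commuting power series is given by its coefficients on monomials, a
   monomial being a sequence of variables. *)
Definition series2 := seq bool -> int.

Definition series_one : series2 := fun M => (M == [::])%:R.

Definition series_mul (f g : series2) : series2 :=
  fun M => \sum_(i < (size M).+1) f (take i M) * g (drop i M).

(* The expansions of x and x^-1: 1 + x, and (1 + x)^-1 = 1 - x + x^2 - x^3 + ... *)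
Definition magnus_letter (l : bool * bool) : series2 :=
  fun M => if l.2 then (M == nseq (size M) l.1)%:R * (-1) ^+ size M
           else ((M == [::]) || (M == [:: l.1]))%:R.

Definition magnus (u : word bool) : series2 :=
  foldr (fun l f => series_mul (magnus_letter l) f) series_one u.

(** * The invariants *)

(* Sequences in {1,2} are boolean sequences, [false] standing for 1 and
   [true] for 2, in accordance with the encoding of a and v.
   [mu D (rcons J i)] is mu_{J|i}, computed at q = |J| + 1. *)
Definition mu (R : realType) (D : vknot_diagram R) (I : seq bool) : int :=
  if I is x :: I' then
    if last x I' then 0 else magnus (longitude_at D (size I)) (belast x I')
  else 0.

(* The gcd is 0 on an empty range and ignores zeros. *)
Definition indeterminacy (R : realType) (D : vknot_diagram R) (I : seq bool) :
    nat :=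
  \big[gcdn/0%N]_(m : (size I).-tuple bool
                   | (1 < size (mask m I))%N && (size (mask m I) < size I)%N)
    \big[gcdn/0%N]_(k < size I) `|mu D (rot k (mask m I))|%N.

(* The residue class of mu_{J|1} modulo Delta_{J|1}, by its canonical
   representative ([modz] by 0 is the identity). *)
Definition zh (R : realType) (D : vknot_diagram R) (J : seq bool) : int :=
  let I := rcons J false in (mu D I %% (indeterminacy D I)%:Z)%Z.

(** * The generalized Alexander polynomial *)

(* Z[t^+-1, v^+-1] is taken as a subring of the field Q(t, v). *)
Definition ratfun2 := {fraction {poly {poly int}}}.

Definition t_ : ratfun2 := tofrac 'X.
Definition v_ : ratfun2 := tofrac ('X%:P).

Definition laurent (x : ratfun2) : Prop :=
  exists (p : {poly {poly int}}) (i j : nat), x = tofrac p / (t_ ^+ i * v_ ^+ j).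

Definition laurent_dvd (d x : ratfun2) : Prop :=
  exists2 c : ratfun2, laurent c & x = c * d.

Definition laurent_gcd (S : ratfun2 -> Prop) (d : ratfun2) : Prop :=
  [/\ laurent d,
      forall x, S x -> laurent_dvd d x
    & forall e, laurent e -> (forall x, S x -> laurent_dvd e x) ->
        laurent_dvd e d].

(* The Fox derivative of a word with respect to the generator x, followed by
   the ring homomorphism induced by [h]:
   D(l u) = D(l) + l D(u),  D(x) = 1,  D(x^-1) = - x^-1. *)
Fixpoint fox (I : eqType) (K : fieldType) (h : I -> K) (x : I) (u : word I)
    {struct u} : K :=
  match u with
  | [::] => 0
  | (y, false) :: u' => (y == x)%:R + h y * fox h x u'
  | (y, true) :: u' => - ((y == x)%:R * (h y)^-1) + (h y)^-1 * fox h x u'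
  end.

Definition abelianize (n : nat) (x : gen n) : ratfun2 :=
  if x is Some _ then t_ else v_.

(* Columns are indexed by the short arcs followed by v. *)
Definition alexander_matrix (R : realType) (D : vknot_diagram R) :
    'M[ratfun2]_(npass D, (narcs (npass D)).+1) :=
  \matrix_(i, j) fox (@abelianize (npass D)) (unlift ord_max j) (relator D i).

Definition is_minor (K : comNzRingType) (r c k : nat) (A : 'M[K]_(r, c)) (x : K) :
    Prop :=
  exists (f : 'I_k -> 'I_r) (g : 'I_k -> 'I_c),
    [/\ {homo f : i j / (i < j)%N}, {homo g : i j / (i < j)%N}
      & x = \det (mxsub f g A)].

(* [p] is a gcd of the generators of the first elementary ideal, i.e. the
   multi-variable Alexander polynomial, up to units, of the link of K together
   with the component whose meridian is v.  The generalized Alexander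
   polynomial of K is taken in this normalization; other ones differ by an
   invertible change of variables.  There are narcs n + 1 generators, so the
   minors have size narcs n; for n = 0 there are none and p = 0. *)
Definition generalized_alexander_polynomial (R : realType) (D : vknot_diagram R)
    (p : ratfun2) : Prop :=
  laurent_gcd (is_minor (narcs (npass D)) (alexander_matrix D)) p.

(* Main.v *)
From mathcomp Require Import all_boot all_order all_algebra.
From mathcomp Require Import boolp reals ring.
Require Import Defs.
Set Implicit Arguments.
Unset Strict Implicit.
Unset Printing Implicit Defensive.
Import GRing.Theory.
Local Open Scope ring_scope.

(** Since the gcd indeterminacies are built from shorter sequences, vanishing of
    all the residue classes forces all the integers mu_{J|1} to vanish.  Hence
    for every q the longitude maps under phi^(q) to an element of the free group
    F whose Magnus expansion is 1 in degrees less than q.  In a group where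
    a_{j+1} is a conjugated by l_j for j < n, the last relation says that l_n
    commutes with a; as the longitude is l_n times a power of a_1, triviality
    of the longitude gives that relation too.  So phi^(q) kills all the
    relators of the extended group up to terms of high degree (weqmod_relator).

    If phi^(q) were an honest homomorphism to F, the Fox derivatives of the
    images of the generators with respect to a would form a vector z in the
    kernel of the Alexander matrix, with entry 0 at v and entry 1 at a_1
    because v and a_1 go to v and a (fox_wsubst, the chain rule).  Being
    nonzero, it would make the determinant of the short-arc columns vanish.  As
    phi^(q) respects the relations only in degrees less than q, one gets instead
    that this determinant lies in the (q-1)-st power of the ideal (t - 1, v - 1)
    of the local ring at t = v = 1.  The link between Magnus degrees and powers
    of this ideal is that the coefficients of the Fox derivative of u are those
    coefficients of u which belong to the monomials ending in a
    (fox_trunc_eval).  The powers of the ideal meet in 0 (adic_eq0), so the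
    determinant is 0.

    Finally the fundamental formula of the Fox calculus makes the column of v a
    combination of the columns of the short arcs, so the remaining maximal
    minors are 0 as well. *)

(** * Non-commuting power series *)

(** A series is its constant term plus the sum over m of [rder m f] times the
    variable m on the right.  Most identities below are proved by comparing
    constant terms and right derivatives: since the constant term of the
    expansion of a word is 1, the product rule is then that of Fox. *)
Definition rder (m : bool) (f : series2) : series2 := fun M => f (rcons M m).

Lemma rder_eq (f g : series2) :
  f [::] = g [::] -> (forall m, rder m f = rder m g) -> f = g.
Proof.
move=> fg0 fgD; apply: funext => M; case/lastP: M => [//|M m].
exact: (congr1 (fun h : series2 => h M) (fgD m)).
Qed.

Lemma series_mul_nil f g : series_mul f g [::] = f [::] * g [::].
Proof. by rewrite /series_mul big_ord_recl big_ord0 addr0. Qed.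

Lemma rder_mul m f g M :
  rder m (series_mul f g) M =
  series_mul f (rder m g) M + rder m f M * g [::].
Proof.
rewrite /rder /series_mul size_rcons big_ord_recr /=; congr (_ + _).
  apply: eq_bigr => i _; have iM : (i <= size M)%N by rewrite -ltnS.
  by rewrite -cats1 takel_cat // drop_cat; case: ltngtP iM => // [_|->] _;
     rewrite ?cats1 // subnn drop0 drop_size.
by rewrite take_oversize ?size_rcons // drop_oversize // size_rcons.
Qed.

Lemma series_mulDr f g h M :
  series_mul f (fun N => g N + h N) M = series_mul f g M + series_mul f h M.
Proof.
by rewrite /series_mul -big_split; apply: eq_bigr => i _; rewrite mulrDr.
Qed.

Lemma series_mulZr f g (c : int) M :
  series_mul f (fun N => g N * c) M = series_mul f g M * c.
Proof. by rewrite /series_mul mulr_suml; apply: eq_bigr => i _; rewrite mulrA. Qed.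

Lemma series_mulA f g h :
  series_mul f (series_mul g h) = series_mul (series_mul f g) h.
Proof.
apply: funext => M; elim/last_ind: M f g h => [|M m IH] f g h.
  by rewrite !series_mul_nil mulrA.
change (rder m (series_mul f (series_mul g h)) M
        = rder m (series_mul (series_mul f g) h) M).
rewrite !rder_mul series_mul_nil.
have -> : rder m (series_mul g h)
          = fun N => series_mul g (rder m h) N + rder m g N * h [::].
  by apply: funext => N; rewrite rder_mul.
by rewrite series_mulDr series_mulZr IH mulrDl mulrA addrA.
Qed.

Lemma rder_one m M : rder m series_one M = 0.
Proof. by rewrite /rder /series_one; case: M. Qed.

Lemma series_mul0r f M : series_mul f (fun=> 0) M = 0.
Proof. by rewrite /series_mul big1 // => i _; rewrite mulr0. Qed.

Lemma series_mulr1 f : series_mul f series_one = f.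
Proof.
apply: rder_eq => [|m]; first by rewrite series_mul_nil mulr1.
apply: funext => M; rewrite rder_mul (_ : rder m _ = fun=> 0) ?series_mul0r.
  by rewrite add0r mulr1.
by apply: funext => N; rewrite rder_one.
Qed.

Lemma series_mul1r f : series_mul series_one f = f.
Proof.
apply: funext => M; rewrite /series_mul big_ord_recl take0 drop0 mul1r.
rewrite big1 ?addr0 // => i _; rewrite /series_one /=.
by case: M i => [[[]]//|m M i]; rewrite mul0r.
Qed.

Lemma rder_gen (m x : bool) M :
  rder m (magnus_letter (x, false)) M = series_one M * (m == x)%:R.
Proof.
rewrite /rder /magnus_letter /series_one /=; case: M => [|m' M] /=.
  by rewrite eqseq_cons eqxx andbT mul1r.
by rewrite eqseq_cons; case: M => [|??] /=; rewrite andbF mul0r.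
Qed.

Lemma rder_gen_inv (m x : bool) M :
  rder m (magnus_letter (x, true)) M =
  magnus_letter (x, true) M * - (m == x)%:R.
Proof.
rewrite /rder /magnus_letter /= size_rcons.
have -> : (rcons M m == nseq (size M).+1 x) = (M == nseq (size M) x) && (m == x).
  rewrite -[in LHS]addn1 nseqD /= cats1 eqseq_rcons //.
by case: (M == _); case: (m == x); rewrite /= ?mul1r ?mul0r
  ?mulr0 ?oppr0 ?exprS ?mulrN1 ?mulN1r ?mulr0.
Qed.

Lemma magnus_letter_nil l : magnus_letter l [::] = 1.
Proof. by case: l => x []. Qed.

Lemma magnus_letterV l :
  series_mul (magnus_letter l) (magnus_letter (l.1, ~~ l.2)) = series_one.
Proof.
apply: funext; elim/last_ind => [|M m IH].
  by rewrite series_mul_nil !magnus_letter_nil.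
change (rder m (series_mul (magnus_letter l) (magnus_letter (l.1, ~~ l.2))) M
        = rder m series_one M).
rewrite rder_mul magnus_letter_nil mulr1 rder_one.
case: l IH => x [] /= IH.
  rewrite rder_gen_inv.
  have -> : rder m (magnus_letter (x, false)) = fun N => series_one N * (m == x)%:R.
    by apply: funext => N; rewrite rder_gen.
  by rewrite series_mulZr series_mulr1 mulrN subrr.
have -> : rder m (magnus_letter (x, true))
          = fun N => magnus_letter (x, true) N * - (m == x)%:R.
  by apply: funext => N; rewrite rder_gen_inv.
by rewrite series_mulZr IH rder_gen mulrN addNr.
Qed.

(** Left multiplication by the variable x. *)
Definition shift (x : bool) (f : series2) : series2 :=
  fun M => if M is m :: M' then (m == x)%:R * f M' else 0.

Lemma magnus_gen_mul x f M :
  series_mul (magnus_letter (x, false)) f M = f M + shift x f M.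
Proof.
rewrite /series_mul big_ord_recl take0 drop0 magnus_letter_nil mul1r.
congr (_ + _); case: M => [|m M] /=; first by rewrite big_ord0.
rewrite big_ord_recl /= take0 drop0 big1 ?addr0.
  by rewrite /magnus_letter /= eqseq_cons eqxx andbT.
move=> i _; rewrite /magnus_letter /= eqseq_cons.
by case: M i => [[[]]//|m' M i]; rewrite /= andbF mul0r.
Qed.

(** * Words modulo terms of large Magnus degree *)

Lemma magnus_cat u w : magnus (u ++ w) = series_mul (magnus u) (magnus w).
Proof. by elim: u => [|l u IH] /=; rewrite ?series_mul1r // IH series_mulA. Qed.

Lemma magnus_nil u : magnus u [::] = 1.
Proof. by elim: u => //= l u IH; rewrite series_mul_nil IH magnus_letter_nil. Qed.

Lemma winv_cons (I : Type) (l : I * bool) u :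
  winv (l :: u) = winv u ++ [:: (l.1, ~~ l.2)].
Proof. by rewrite /winv /= rev_cons cats1. Qed.

Lemma winvK (I : Type) : involutive (@winv I).
Proof.
move=> u; rewrite /winv map_rev revK -map_comp -[RHS]map_id.
by apply: eq_map => -[x b] /=; rewrite negbK.
Qed.

Lemma winv_cat (I : Type) (u w : word I) : winv (u ++ w) = winv w ++ winv u.
Proof. by rewrite /winv map_cat rev_cat. Qed.

Lemma magnus_mulVr u : series_mul (magnus u) (magnus (winv u)) = series_one.
Proof.
elim: u => [|l u IH]; first by rewrite series_mul1r.
rewrite winv_cons magnus_cat /= series_mulr1.
rewrite -series_mulA [X in series_mul _ X]series_mulA IH series_mul1r.
exact: magnus_letterV.
Qed.

Lemma magnus_mulVl u : series_mul (magnus (winv u)) (magnus u) = series_one.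
Proof. by rewrite -{2}(winvK u) magnus_mulVr. Qed.

Definition series_eqmod (d : nat) (f g : series2) : Prop :=
  forall M, (size M <= d)%N -> f M = g M.

Lemma series_eqmod_mul d f f' g g' :
  series_eqmod d f f' -> series_eqmod d g g' ->
  series_eqmod d (series_mul f g) (series_mul f' g').
Proof.
move=> ff gg M Md; apply: eq_bigr => i _.
rewrite ff ?gg // ?size_drop ?size_take ?(leq_trans (leq_subr _ _)) //.
by case: ifP => // /ltnW iM; rewrite (leq_trans iM).
Qed.

(** This is congruence modulo the (d+1)-st term of the lower central series of
    the free group.  It plays the role of equality in the nilpotent quotients. *)
Definition weqmod (d : nat) (u w : word bool) : Prop :=
  series_eqmod d (magnus u) (magnus w).

Lemma weqmod_refl d u : weqmod d u u. Proof. by []. Qed.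

Lemma weqmod_sym d u w : weqmod d u w -> weqmod d w u.
Proof. by move=> H M /H. Qed.

Lemma weqmod_trans d u w z : weqmod d u w -> weqmod d w z -> weqmod d u z.
Proof. by move=> H1 H2 M Md; rewrite H1 // H2. Qed.

Lemma weqmod_le d d' u w : (d' <= d)%N -> weqmod d u w -> weqmod d' u w.
Proof. by move=> le H M Md; apply: H; apply: leq_trans Md le. Qed.

Lemma weqmod0 u w : weqmod 0 u w.
Proof. by case=> // _; rewrite !magnus_nil. Qed.

Lemma weqmod_cat d u u' w w' :
  weqmod d u u' -> weqmod d w w' -> weqmod d (u ++ w) (u' ++ w').
Proof. by move=> uu ww; rewrite /weqmod !magnus_cat; apply: series_eqmod_mul. Qed.

Lemma weqmod_winv d u w : weqmod d u w -> weqmod d (winv u) (winv w).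
Proof.
move=> uw M Md; rewrite -[LHS](congr1 (fun f => f M) (series_mulr1 _)).
rewrite -(magnus_mulVr w) -[RHS](congr1 (fun f => f M) (series_mul1r _)).
rewrite -(magnus_mulVl u) -series_mulA.
apply: series_eqmod_mul Md => //; apply: series_eqmod_mul => //.
exact: weqmod_sym.
Qed.

Lemma rder_conj x u m M :
  rder m (magnus (winv u ++ wgen x ++ u)) M =
  series_mul (magnus (winv u)) (shift x (rder m (magnus u))) M
  + magnus (winv u) M * (m == x)%:R.
Proof.
have D0 : series_mul (magnus (winv u)) (rder m (magnus u)) M
          + rder m (magnus (winv u)) M = 0.
  by rewrite -(rder_one m M) -(magnus_mulVl u) rder_mul magnus_nil mulr1.
rewrite magnus_cat rder_mul /= series_mul_nil magnus_letter_nil magnus_nil !mulr1.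
have -> : rder m (series_mul (magnus_letter (x, false)) (magnus u)) =
    fun N => rder m (magnus u) N + shift x (rder m (magnus u)) N
             + series_one N * (m == x)%:R.
  by apply: funext => N; rewrite rder_mul magnus_nil mulr1 magnus_gen_mul rder_gen.
rewrite (series_mulDr _ (fun N => rder m (magnus u) N + shift x (rder m (magnus u)) N)
  (fun N => series_one N * (m == x)%:R)) series_mulZr series_mulr1 series_mulDr.
by rewrite addrAC [X in X + _]addrAC D0 add0r.
Qed.

(** The expansion of u^-1 x u is 1 + U^-1 X U, where U is the expansion of u and
    the variable X has degree one: an error of degree d + 1 in U shows only in
    degree d + 2. *)
Lemma weqmod_conj d x u w : weqmod d u w ->
  weqmod d.+1 (winv u ++ wgen x ++ u) (winv w ++ wgen x ++ w).
Proof.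
move=> uw M; case/lastP: M => [|M m]; rewrite ?magnus_nil // size_rcons ltnS => Md.
rewrite -![magnus _ (rcons _ _)]/(rder m _ _) !rder_conj.
congr (_ + _ * _); last exact: weqmod_winv Md.
apply: series_eqmod_mul Md; first exact: weqmod_winv.
case=> //= m' N Nd; congr (_ * _); apply: uw.
by rewrite size_rcons.
Qed.

Lemma weqmod_catV d u : weqmod d (u ++ winv u) [::].
Proof. by move=> M _; rewrite magnus_cat magnus_mulVr. Qed.

Lemma weqmod_Vcat d u : weqmod d (winv u ++ u) [::].
Proof. by move=> M _; rewrite magnus_cat magnus_mulVl. Qed.

Lemma wsubst_cat (I J : Type) (h : I -> word J) u w :
  wsubst h (u ++ w) = wsubst h u ++ wsubst h w.
Proof. by rewrite /wsubst map_cat flatten_cat. Qed.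

Lemma wsubst_winv (I J : Type) (h : I -> word J) u :
  wsubst h (winv u) = winv (wsubst h u).
Proof.
elim: u => //= -[x b] u IH; rewrite winv_cons wsubst_cat IH [wsubst h (_ :: u)]/=.
rewrite /wsubst /= -/(wsubst h u) winv_cat cats0.
by case: b; rewrite //= winvK.
Qed.

Lemma weqmod_wsubst (I : Type) d (h h' : I -> word bool) u :
  (forall x, weqmod d (h x) (h' x)) -> weqmod d (wsubst h u) (wsubst h' u).
Proof.
move=> hh; elim: u => // -[x b] u IH; rewrite /wsubst /=.
by apply: weqmod_cat IH; case: b => //=; apply: weqmod_winv.
Qed.

(** * The homomorphisms phi *)

Lemma weqmod_wexp_comm d x k :
  weqmod d (wexp x k ++ wgen x) (wgen x ++ wexp x k).
Proof.
rewrite /wexp; elim: `|k|%N => //= n IH.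
apply: weqmod_trans (_ : weqmod d (_ :: wgen x ++ nseq n (x, k < 0)) _).
  exact: (@weqmod_cat d [:: _] [:: _]).
case: (k < 0) => //.
have := weqmod_cat (@weqmod_Vcat d (wgen x)) (@weqmod_refl d (nseq n (x, true))).
have := weqmod_cat (@weqmod_catV d (wgen x)) (@weqmod_refl d (nseq n (x, true))).
by move=> /weqmod_sym H1 H2; apply: weqmod_trans H2 H1.
Qed.

Lemma wsubst_wexp (I J : Type) (h : I -> word J) x y k :
  h x = wgen y -> wsubst h (wexp x k) = wexp y k.
Proof.
move=> hx; rewrite /wexp; elim: `|k|%N => // m IH.
by rewrite /wsubst /= -/(wsubst _ _) IH hx; case: (k < 0).
Qed.

Lemma inord00 m : inord 0 = ord0 :> 'I_m.+1.
Proof. by apply/val_inj; rewrite /= inordK. Qed.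

Section Diagram.
Variables (R : realType) (D : vknot_diagram R).
Local Notation n := (npass D).

Lemma phi_gen_arc q (j : 'I_(narcs n)) :
  phi_gen D q.+2 (Some j) =
  let l := wsubst (phi_gen D q.+1) (partial_longitude D j) in
  winv l ++ fa ++ l.
Proof. by []. Qed.

Lemma phi_gen_v q : phi_gen D q None = fv.
Proof. by case: q => [|[]]. Qed.

Lemma phi_gen_arc0 q : phi_gen D q (Some ord0) = fa.
Proof. by case: q => [|[]]. Qed.

(** Each step of the recursion conjugates by longitudes computed at the previous
    step, so that [weqmod_conj] adds one degree of agreement. *)
Lemma phi_gen_step q x : weqmod q (phi_gen D q x) (phi_gen D q.+1 x).
Proof.
elim: q x => [|q IH] x; first exact: weqmod0.
case: x => [j|]; last by rewrite !phi_gen_v.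
case: q IH => [_|q IH].
  exact: (@weqmod_conj 0 false [::] _ (@weqmod0 _ _)).
by rewrite [phi_gen D q.+2 _]phi_gen_arc; apply: weqmod_conj; apply: weqmod_wsubst.
Qed.

Lemma phi_gen_stable q p x : (q <= p)%N -> weqmod q (phi_gen D q x) (phi_gen D p x).
Proof.
move/subnK <-; elim: (p - q)%N => // k IH.
apply: weqmod_trans IH _; apply: weqmod_le _ (@phi_gen_step (k + q) x).
exact: leq_addl.
Qed.

(** * Vanishing of the invariants *)

Lemma mu_rcons J : mu D (rcons J false) = magnus (longitude_at D (size J).+1) J.
Proof.
by case: J => //= x J; rewrite last_rcons belast_rcons size_rcons.
Qed.

(** By induction on the length all the integers entering the indeterminacy are
    0, so the residue class is the integer itself. *)
Lemma mu_vanish : (forall J, J != [::] -> zh D J = 0) ->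
  forall I, (1 < size I)%N -> mu D I = 0.
Proof.
move=> zh0 I; move: {2}(size I) (leqnn (size I)) => N.
elim: N I => [|N IH] I; first by rewrite leqn0 => /eqP ->.
case/lastP: I => // J [] sJ J0.
  by case: J sJ J0 => //= x J _ _; rewrite last_rcons.
have /zh0 : J != [::] by case: J J0 {sJ}.
rewrite /zh; suff -> : indeterminacy D (rcons J false) = 0%N by rewrite modz0.
rewrite /indeterminacy big1 // => m /andP[m1 m2]; rewrite big1 // => k _.
rewrite IH ?size_rot // -ltnS; exact: leq_trans m2 sJ.
Qed.

(** The invariant of J is read off from phi^(q) for q = |J| + 1 only; stability
    transports it to all larger q. *)
Lemma weqmod_longitude q : (forall J, J != [::] -> zh D J = 0) ->
  weqmod q (longitude_at D q.+1) [::].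
Proof.
move=> zh0 J Jq; case: (eqVneq J [::]) => [->|J0]; first by rewrite magnus_nil.
have J1 : (0 < size J)%N by rewrite lt0n size_eq0.
have := mu_vanish zh0 (I := rcons J false); rewrite size_rcons ltnS => /(_ J1).
have -> : magnus [::] J = 0 by rewrite /= /series_one (negPf J0).
rewrite mu_rcons => mu0; apply: etrans mu0.
apply: weqmod_sym (leqnSn _).
by apply: weqmod_wsubst => x; apply: phi_gen_stable.
Qed.

Lemma partial_longitudeS j :
  partial_longitude D j.+1 = partial_longitude D j ++ conjugator D j.
Proof.
by rewrite /partial_longitude /mkseq -addn1 iotaD map_cat flatten_cat /= cats0.
Qed.

Lemma phi_gen_arcE q j : (j < n)%N ->
  phi_gen D q.+2 (arc n j) =
  winv (wsubst (phi_gen D q.+1) (partial_longitude D j)) ++ fa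
  ++ wsubst (phi_gen D q.+1) (partial_longitude D j).
Proof. by move=> jn; rewrite phi_gen_arc inordK // /narcs; case: (n) jn. Qed.

(** The longitude is l times a power of a_1 and its image is trivial up to
    degree q, so there l is a power of a and commutes with a. *)
Lemma weqmod_closing q : (forall J, J != [::] -> zh D J = 0) ->
  let l := wsubst (phi_gen D q.+1) (partial_longitude D n) in
  weqmod q (winv l ++ fa ++ l) fa.
Proof.
move=> zh0 l; have := @weqmod_longitude q zh0.
rewrite /longitude_at /longitude wsubst_cat -/l.
set e := wexp _ _.
have -> : wsubst (phi_gen D q.+1) e = wexp false (- arc_exponent (partial_longitude D n)).
  by apply: wsubst_wexp; rewrite /arc inord00 phi_gen_arc0.
set k := wexp _ _ => lk.
have lE : weqmod q l (winv k).
  apply: (@weqmod_trans q _ (l ++ k ++ winv k)).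
    rewrite -{1}[l]cats0; apply: weqmod_cat => //.
    exact: weqmod_sym (@weqmod_catV _ _).
  by rewrite catA; apply: (weqmod_cat lk).
apply: (@weqmod_trans q _ (k ++ fa ++ winv k)).
  apply: weqmod_cat; last exact: weqmod_cat.
  by rewrite -[X in weqmod _ _ X]winvK; apply: weqmod_winv.
rewrite catA; apply: (@weqmod_trans q _ ((fa ++ k) ++ winv k)).
  by apply: weqmod_cat => //; apply: weqmod_wexp_comm.
rewrite -catA -[X in weqmod _ _ X]cats0; apply: weqmod_cat => //.
exact: weqmod_catV.
Qed.

(** Replacing phi^(q+1) by phi^(q+2) on the two arcs of a relator turns it into
    an identity between conjugates of a, except at the last passage, where
    [weqmod_closing] closes the cycle. *)
Lemma weqmod_relator q i : (forall J, J != [::] -> zh D J = 0) ->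
  weqmod q (wsubst (phi_gen D q.+1) (relator D i)) [::].
Proof.
move=> zh0; set ph := wsubst _.
have next : weqmod q
    (winv (ph (conjugator D i)) ++ phi_gen D q.+2 (arc n i) ++ ph (conjugator D i))
    (phi_gen D q.+2 (arc n (i.+1 %% n))).
  rewrite phi_gen_arcE // -/ph.
  have -> : forall w l : word bool, winv w ++ (winv l ++ fa ++ l) ++ w
            = winv (l ++ w) ++ fa ++ (l ++ w).
    by move=> w l; rewrite winv_cat !catA.
  rewrite -wsubst_cat -partial_longitudeS.
  case: (ltngtP i.+1 n) (ltn_ord i) => // [lt _|eq _].
    by rewrite modn_small // phi_gen_arcE.
  by rewrite eq modnn /arc inord00 phi_gen_arc0; apply: weqmod_closing.
have arcE x : wsubst (phi_gen D q.+1) (wgen x) = phi_gen D q.+1 x.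
  by rewrite /wsubst /= cats0.
have stepE x : weqmod q (phi_gen D q.+1 x) (phi_gen D q.+2 x).
  by apply: weqmod_le _ (@phi_gen_step _ _).
rewrite /relator /ph !wsubst_cat !wsubst_winv !arcE -/ph.
set z := phi_gen D q.+1 (arc n (i.+1 %% n)).
rewrite [X in _ ++ X]catA catA.
apply: (@weqmod_trans q _ (z ++ winv z)); last exact: weqmod_catV.
apply: weqmod_cat => //; apply: weqmod_trans (weqmod_sym (stepE _)).
apply: weqmod_trans next; apply: weqmod_cat => //; apply: weqmod_cat => //.
Qed.
End Diagram.

(** * Fox calculus *)

Section Fox.
Variable K : fieldType.

Definition wval (I : Type) (h : I -> K) (u : word I) : K :=
  \prod_(l <- u) (if l.2 then (h l.1)^-1 else h l.1).

Lemma wval_cat (I : Type) (h : I -> K) u w : wval h (u ++ w) = wval h u * wval h w.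
Proof. by rewrite /wval big_cat. Qed.

Lemma wval_cons (I : Type) (h : I -> K) l u :
  wval h (l :: u) = wval h [:: l] * wval h u.
Proof. exact: (wval_cat h [:: l]). Qed.

Lemma wval_gen (I : Type) (h : I -> K) x : wval h (wgen x) = h x.
Proof. by rewrite /wval big_seq1. Qed.

Lemma wval_winv (I : Type) (h : I -> K) u : wval h (winv u) = (wval h u)^-1.
Proof.
elim: u => [|[x b] u IH]; first by rewrite /wval !big_nil invr1.
rewrite winv_cons wval_cat IH mulrC /wval big_seq1 big_cons invfM /=.
by case: b; rewrite //= invrK.
Qed.

Lemma wval_neq0 (I : Type) (h : I -> K) u : (forall y, h y != 0) -> wval h u != 0.
Proof.
move=> h0; rewrite /wval; elim/big_ind: _ => //.
- exact: oner_neq0.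
- by move=> *; rewrite mulf_neq0.
by move=> l _; case: ifP; rewrite ?invr_eq0.
Qed.

Lemma fox_letter (I : eqType) (h : I -> K) x l u :
  fox h x (l :: u) = fox h x [:: l] + wval h [:: l] * fox h x u.
Proof. by case: l => y []; rewrite /wval big_seq1 /= mulr0 addr0. Qed.

Lemma fox_cat (I : eqType) (h : I -> K) x u w :
  fox h x (u ++ w) = fox h x u + wval h u * fox h x w.
Proof.
elim: u => [|l u IH]; first by rewrite /wval big_nil mul1r add0r.
rewrite cat_cons fox_letter IH (fox_letter _ _ _ u) (wval_cons _ l u).
by rewrite mulrDr addrA mulrA.
Qed.

Lemma fox_winv (I : eqType) (h : I -> K) x u : (forall y, h y != 0) ->
  fox h x (winv u) = - (wval h u)^-1 * fox h x u.
Proof.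
move=> h0; elim: u => [|l u IH]; first by rewrite mulr0.
have inv1 : fox h x [:: (l.1, ~~ l.2)] = - (wval h [:: l])^-1 * fox h x [:: l].
  case: l => y b; rewrite /wval big_seq1.
  by case: b => /=; move: (_%:R) (h0 y) => e hy; field; rewrite ?hy ?oner_neq0.

rewrite winv_cons fox_cat IH inv1 wval_winv (fox_letter _ _ _ u) (wval_cons _ l u).
by field; rewrite !wval_neq0.
Qed.

Lemma fox_fundamental (I : finType) (h : I -> K) u : (forall y, h y != 0) ->
  \sum_i fox h i u * (h i - 1) = wval h u - 1.
Proof.
move=> h0; elim: u => [|l u IH].
  by rewrite /wval big_nil subrr big1 // => i _; rewrite mul0r.
have l1 : \sum_i fox h i [:: l] * (h i - 1) = wval h [:: l] - 1.
  rewrite /wval big_seq1; case: l => y b /=.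
  rewrite (bigD1 y) //= big1 => [|i /negPf iy]; last first.
    by rewrite eq_sym iy; case: b; rewrite ?mul0r ?oppr0 ?mulr0 ?addr0 mul0r.
  rewrite eqxx; case: b; rewrite ?mulr0 ?addr0 mul1r //.
  by rewrite mulNr mulrBr mulVf // mulr1 opprB.
under eq_bigr => i _ do rewrite fox_letter mulrDl -mulrA.
rewrite big_split /= -mulr_sumr l1 IH (wval_cons _ l u) mulrBr mulr1.
by rewrite addrC addrA addrNK.
Qed.

(** Fox's chain rule.  When the homomorphism kills the word u, it says that the
    derivatives of the images of the generators are orthogonal to the row of
    Fox derivatives of u. *)
Lemma fox_wsubst (I : finType) (J : eqType) (h : J -> K) (phi : I -> word J)
    (x : J) u : (forall y, h y != 0) ->
  fox h x (wsubst phi u) =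
  \sum_i fox (fun i => wval h (phi i)) i u * fox h x (phi i).
Proof.
move=> h0; elim: u => [|[y b] u IH].
  by rewrite big1 // => i _; rewrite mul0r.
under eq_bigr => i _ do rewrite fox_letter mulrDl -mulrA.
rewrite big_split /= -mulr_sumr -IH /wsubst /= fox_cat -/(wsubst _ u).
congr (_ + _ * _); last first.
  by rewrite [RHS]/wval big_seq1; case: b; rewrite //= wval_winv.
rewrite (bigD1 y) //= big1 => [|i /negPf iy]; last first.
  by rewrite eq_sym iy; case: b; rewrite ?mul0r ?oppr0 ?mulr0 ?addr0 mul0r.
by rewrite eqxx; case: b; rewrite ?mulr0 ?addr0 mul1r // fox_winv.
Qed.

Lemma eq_fox (I : eqType) (h h' : I -> K) x u : h =1 h' -> fox h x u = fox h' x u.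
Proof. by move=> hh; elim: u => //= -[y b] u IH; rewrite hh IH. Qed.
End Fox.

(** * The augmentation-adic filtration of the field of rational functions *)

Notation poly2 := {poly {poly int}}.

(** The substitution t -> 1 + s (t - 1), v -> 1 + s (v - 1), with s a new
    variable, turns the order of vanishing at t = v = 1 into divisibility by
    powers of s; setting s = 1 undoes it. *)
Definition line (a : poly2) : {poly poly2} := 1 + (a - 1) *: 'X.

Definition deform_coef : {rmorphism {poly int} -> {poly poly2}} :=
  horner_morph (fun c : int => mulrC (line 'X%:P) (c%:~R : {poly poly2})).

Definition deform : {rmorphism poly2 -> {poly poly2}} :=
  horner_morph (fun c : {poly int} => mulrC (line 'X) (deform_coef c)).

Lemma line1 a : (line a).[1] = a.
Proof. by rewrite /line hornerD hornerZ hornerX hornerC mulr1 addrC subrK. Qed.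

Lemma line0 a : (line a).[0] = 1.
Proof. by rewrite /line hornerD hornerZ hornerX hornerC mulr0 addr0. Qed.

Lemma deform_coef1 c : (deform_coef c).[1] = c%:P.
Proof.
elim/poly_ind: c => [|c k IH]; first by rewrite rmorph0 horner0 polyC0.
rewrite rmorphD rmorphM /= horner_morphX horner_morphC hornerD hornerM IH line1.
rewrite -[in RHS](intz k) !polyCD polyCM !rmorph_int.
congr (_ + _); exact: (rmorph_int (horner_eval (1 : poly2)) k).
Qed.

Lemma deform1 p : (deform p).[1] = p.
Proof.
elim/poly_ind: p => [|p c IH]; first by rewrite rmorph0 horner0.
rewrite rmorphD rmorphM /= horner_morphX horner_morphC hornerD hornerM IH line1.
by rewrite deform_coef1.
Qed.

Lemma deform_t : deform 'X = line 'X.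
Proof. exact: horner_morphX. Qed.

Lemma deform_v : deform 'X%:P = line 'X%:P.
Proof. by rewrite /= horner_morphC /= horner_morphX. Qed.

(** This is the q-th power of the ideal (t - 1, v - 1) in the local ring of
    fractions whose denominators take the value 1 at t = v = 1: the value at
    s = 0 of the deformation of d is d(1, 1). *)
Definition adic (q : nat) (z : ratfun2) : Prop :=
  exists p d P, [/\ z = tofrac p / tofrac d, deform p = P * 'X^q & (deform d).[0] = 1].

Lemma deform0_neq0 d : (deform d).[0] = 1 -> tofrac d != 0.
Proof.
move=> d1; rewrite tofrac_eq0; apply/eqP => d0; move/eqP: d1.
by rewrite d0 rmorph0 horner0 eq_sym oner_eq0.
Qed.

Lemma adicM q r y z : adic q y -> adic r z -> adic (q + r) (y * z).
Proof.
move=> [p [d [P [-> pP d1]]]] [p' [d' [P' [-> pP' d1']]]].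
exists (p * p'), (d * d'), (P * P'); split.
- by rewrite !tofracM invfM mulrACA.
- by rewrite rmorphM pP pP' exprD mulrACA.
by rewrite rmorphM hornerM d1 d1' mul1r.
Qed.

Lemma adicD q y z : adic q y -> adic q z -> adic q (y + z).
Proof.
move=> [p [d [P [-> pP d1]]]] [p' [d' [P' [-> pP' d1']]]].
exists (p * d' + p' * d), (d * d'), (P * deform d' + P' * deform d); split.
- by rewrite tofracD !tofracM addf_div ?deform0_neq0.
- by rewrite rmorphD !rmorphM pP pP' mulrDl mulrAC [_ * deform d]mulrAC.
by rewrite rmorphM hornerM d1 d1' mul1r.
Qed.

Lemma adic_poly q p P : deform p = P * 'X^q -> adic q (tofrac p).
Proof.
move=> pP; exists p, 1, P; split=> //; last by rewrite rmorph1 hornerC.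
by rewrite tofrac1 invr1 mulr1.
Qed.

Lemma adic0 q : adic q 0.
Proof. by rewrite -tofrac0; apply: (@adic_poly q 0 0); rewrite rmorph0 mul0r. Qed.

Lemma adic_int (c : int) : adic 0 c%:~R.
Proof.
by rewrite -(rmorph_int (@tofrac _)); apply: adic_poly; rewrite expr0 mulr1.
Qed.

Lemma adicN q z : adic q z -> adic q (- z).
Proof. by move=> /(adicM (adic_int (-1))); rewrite mulN1r. Qed.

Lemma adic_le q r z : (r <= q)%N -> adic q z -> adic r z.
Proof.
move=> /subnK <- [p [d [P [-> pP d1]]]].
by exists p, d, (P * 'X^(q - r)); rewrite -mulrA -exprD.
Qed.

Definition abel2 (l : bool) : ratfun2 := if l then v_ else t_.

Lemma abel2E l : exists2 a, abel2 l = tofrac a & deform a = line a.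
Proof.
case: l; first by exists ('X%:P) => //; apply: deform_v.
by exists 'X => //; apply: deform_t.
Qed.

Lemma abel2_neq0 l : abel2 l != 0.
Proof. by have [a -> da] := abel2E l; rewrite deform0_neq0 // da line0. Qed.

Lemma adic_abel2 l : adic 0 (abel2 l).
Proof.
by have [a -> da] := abel2E l; apply: adic_poly; rewrite expr0 mulr1.
Qed.

Lemma adic_abel2V l : adic 0 (abel2 l)^-1.
Proof.
have [a -> da] := abel2E l; exists 1, a, 1.
by rewrite tofrac1 mul1r rmorph1 expr0 mulr1 da line0.
Qed.

Lemma adic_abel2B1 l : adic 1 (abel2 l - 1).
Proof.
have [a -> da] := abel2E l; rewrite -tofrac1 -tofracB.
apply: (@adic_poly _ _ (a - 1)%:P).
by rewrite rmorphB rmorph1 da /line addrAC subrr add0r expr1 mul_polyC.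
Qed.

(** A polynomial with constant term 1 is prime to the variable.  The coefficients
    form only a domain, so the factors of the variable are split off one at a
    time, through the root 0. *)
Lemma dvdp_Xn_unit (R : idomainType) q (P Q : {poly R}) S :
  Q.[0] = 1 -> P * Q = S * 'X^q -> exists T, P = T * 'X^q.
Proof.
move=> Q1; elim: q P S => [|q IH] P S; first by exists P; rewrite mulr1.
move=> PQ; have /factor_theorem [P1 PE] : root P 0.
  have := congr1 (fun p => p.[0]) PQ.
  by rewrite /root !hornerM Q1 mulr1 hornerXn exprS mul0r mulr0 => ->.
rewrite subr0 in PE.
have /IH [T TE] : P1 * Q = S * 'X^q.
  apply: (mulIf (negbT (polyX_eq0 R))).
  by rewrite mulrAC -PE PQ exprSr mulrA.
exists T; by rewrite PE TE exprSr mulrA.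
Qed.

Lemma tofrac_cross_mul (A : idomainType) (z : {fraction A}) (p p' d d' : A) :
  z = tofrac p / tofrac d -> z = tofrac p' / tofrac d' ->
  tofrac d != 0 -> tofrac d' != 0 -> p * d' = p' * d.
Proof.
move=> zE zE' d0 d0'; apply/eqP; rewrite -tofrac_eq !tofracM.
have -> : tofrac p = z * tofrac d by rewrite zE divfK.
have -> : tofrac p' = z * tofrac d' by rewrite zE' divfK.
by rewrite mulrAC.
Qed.

(** If z = p / d then s^q divides the deformation of p times that of a
    denominator prime to s, hence the deformation of p itself; this is absurd
    for large q unless p = 0. *)
Lemma adic_eq0 z : (forall q, adic q z) -> z = 0.
Proof.
move=> az; have [p [d [_ [zE _ d1]]]] := az 0%N.
have d0 := deform0_neq0 d1.
rewrite zE; suff -> : p = 0 by rewrite tofrac0 mul0r.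
rewrite -[p]deform1; suff -> : deform p = 0 by rewrite horner0.
apply/eqP/negPn/negP => p0.
have [p' [d' [P [zE' p'E d1']]]] := az (size (deform p)).
have d0' := deform0_neq0 d1'.
have pd := tofrac_cross_mul zE zE' d0 d0'.
have [T TE] : exists T, deform p = T * 'X^(size (deform p)).
  apply: (@dvdp_Xn_unit _ _ _ (deform d') (P * deform d)) => //.
  by rewrite -rmorphM pd rmorphM p'E mulrAC.
have T0 : T != 0 by apply: contra_neq p0 => T0; rewrite TE T0 mul0r.
have /eqP := congr1 (fun s : {poly poly2} => size s) TE.
rewrite size_mulXn // -{1}[size (deform p)]addn0 eqn_add2l eq_sym size_poly_eq0.
exact/negP.
Qed.

(** * Fox derivatives of words close to 1 *)

(** The image of the part of degree less than q of a series under a -> t - 1,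
    v -> v - 1.  It is additive, and multiplicative modulo [adic q] only.  Reading a
    monomial from its first letter suits induction on words, which grow on the
    left. *)
Fixpoint trunc_eval (q : nat) (f : series2) : ratfun2 :=
  if q is q'.+1 then
    (f [::])%:~R
    + ((abel2 false - 1) * trunc_eval q' (fun M => f (false :: M))
       + (abel2 true - 1) * trunc_eval q' (fun M => f (true :: M)))
  else 0.

Lemma eq_trunc_eval q f g :
  (forall M, (size M < q)%N -> f M = g M) -> trunc_eval q f = trunc_eval q g.
Proof.
elim: q f g => //= q IH f g fg; rewrite fg //.
by congr (_ + (_ * _ + _ * _)); apply: IH => M Mq; apply: fg.
Qed.

Lemma trunc_evalD q f g :
  trunc_eval q (fun M => f M + g M) = trunc_eval q f + trunc_eval q g.
Proof.
elim: q f g => /= [|q IH] f g; first by rewrite addr0.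
by rewrite intrD !IH !mulrDr [RHS]addrACA; congr (_ + _); rewrite addrACA.
Qed.

Lemma trunc_eval0 q f : (forall M, (size M < q)%N -> f M = 0) -> trunc_eval q f = 0.
Proof.
elim: q f => //= q IH f f0; rewrite f0 // !IH ?mulr0 ?addr0 //.
all: by move=> M Mq; apply: f0.
Qed.

Lemma trunc_eval_step q f : adic q (trunc_eval q.+1 f - trunc_eval q f).
Proof.
elim: q f => [|q IH] f.
  by rewrite /= !mulr0 !addr0 subr0; apply: adic_int.
rewrite [trunc_eval q.+2 f]/= [trunc_eval q.+1 f in X in _ - X]/=.
have -> : forall a x y u u' w w' : ratfun2,
    a + (x * u + y * w) - (a + (x * u' + y * w')) = x * (u - u') + y * (w - w').
  by move=> a x y u u' w w'; rewrite opprD addrACA subrr add0r opprD addrACA !mulrBr.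
by apply: adicD; rewrite -add1n; apply: adicM (IH _);
   [apply: (adic_abel2B1 false) | apply: (adic_abel2B1 true)].
Qed.

(** Multiplying by 1 + x on the left adds a shift by one degree, so only the
    term of top degree is evaluated differently on the two sides. *)
Lemma trunc_eval_gen q x f :
  adic q (abel2 x * trunc_eval q f
          - trunc_eval q (series_mul (magnus_letter (x, false)) f)).
Proof.
have -> : series_mul (magnus_letter (x, false)) f = fun M => f M + shift x f M.
  by apply: funext => M; rewrite magnus_gen_mul.
rewrite trunc_evalD; case: q => [|q].
  by rewrite /= mulr0 addr0 subr0; apply: adic0.
have -> : trunc_eval q.+1 (shift x f) = (abel2 x - 1) * trunc_eval q f.
  have e (y : bool) : trunc_eval q (fun M => (y == x)%:R * f M)
             = if y == x then trunc_eval q f else 0.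
    case: ifP => yx; last by apply: trunc_eval0 => M _; rewrite mul0r.
    by apply: eq_trunc_eval => M _; rewrite mul1r.
  by rewrite /= !e mulr0z add0r; case: (x); rewrite /= mulr0 ?addr0 ?add0r.
have -> : forall a y z : ratfun2, a * y - (y + (a - 1) * z) = (a - 1) * (y - z).
  by move=> a y z; rewrite opprD addrA [RHS]mulrBr [(a - 1) * y]mulrBl mul1r.
by rewrite -add1n; apply: adicM; [apply: adic_abel2B1 | apply: trunc_eval_step].
Qed.

(** The case of an inverse letter follows by dividing the previous estimate by
    t or v, both units of the local ring. *)
Lemma trunc_eval_letter q l f :
  adic q (wval abel2 [:: l] * trunc_eval q f
          - trunc_eval q (series_mul (magnus_letter l) f)).
Proof.
case: l => x []; rewrite /wval big_seq1 /=; last exact: trunc_eval_gen.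
set g := series_mul _ f.
(* f is (1 + x) g, which the estimate for a generator applies to. *)
have fE : f = series_mul (magnus_letter (x, false)) g.
  by rewrite /g series_mulA (magnus_letterV (x, false)) series_mul1r.
rewrite {1}fE -[trunc_eval q g](mulKf (abel2_neq0 x)) -mulrBr.
rewrite -[q]add0n; apply: adicM; first exact: adic_abel2V.
by rewrite -opprB; apply/adicN/trunc_eval_gen.
Qed.

Lemma trunc_evalZ q f (c : int) :
  trunc_eval q (fun M => f M * c) = trunc_eval q f * c%:~R.
Proof.
elim: q f => /= [|q IH] f; first by rewrite mul0r.
by rewrite intrM !IH !mulrDl !mulrA.
Qed.

Lemma trunc_eval1 q : trunc_eval q.+1 series_one = 1.
Proof. by rewrite /= !trunc_eval0 ?mulr0 ?addr0. Qed.

Lemma bool_mul_diff (A : comNzRingType) (a e : A) (b : bool) :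
  - (b%:R * a) - e * (- b%:R : int)%:~R = (e - a) * b%:R.
Proof.
by case: b; rewrite ?rmorphN1 ?mulr1 ?mul1r ?oppr0 ?mulr0 ?mul0r ?subr0 ?oppr0 //
  mulrN1 opprK addrC.
Qed.

Lemma adic_bool (b : bool) : adic 0 b%:R.
Proof. exact: (adic_int b%:Z). Qed.

(** The Fox derivative of u with respect to a and the right derivative of its
    expansion obey the same recursion on u, and the letters act on both sides
    in the same way modulo [adic]. *)
Lemma fox_trunc_eval q u :
  adic q.+1 (fox abel2 false u - trunc_eval q.+1 (rder false (magnus u))).
Proof.
elim: u => [|l u IH].
  by rewrite trunc_eval0 ?subr0 => [|M _]; [apply: adic0 | apply: rder_one].
rewrite fox_letter; set w := wval abel2 [:: l].
have -> : rder false (magnus (l :: u)) =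
    fun M => series_mul (magnus_letter l) (rder false (magnus u)) M
             + rder false (magnus_letter l) M.
  by apply: funext => M; rewrite (rder_mul _ _ (magnus u)) magnus_nil mulr1.
rewrite trunc_evalD; set e := trunc_eval _ _.
pose e' := trunc_eval q.+1 (rder false (magnus u)).
have -> : forall a b c : ratfun2,
    a + w * b - (e + c) = (a - c) + (w * (b - e') + (w * e' - e)).
  move=> a b c; rewrite mulrBr [w * b - _ + _]addrA subrK [RHS]addrACA.
  by rewrite opprD [- e - c]addrC.
apply: adicD; last apply: adicD; last exact: trunc_eval_letter.
  case: l @w @e => x [] w e; last first.
    have -> : rder false (magnus_letter (x, false)) =
              fun M => series_one M * (false == x)%:R.
      by apply: funext => M; rewrite rder_gen.
    rewrite trunc_evalZ trunc_eval1 mul1r /= mulr0 addr0 eq_sym.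
    by case: (false == x); rewrite ?mulr1z ?mulr0z subrr; apply: adic0.
  have -> : rder false (magnus_letter (x, true)) =
            fun M => magnus_letter (x, true) M * - (false == x)%:R.
    by apply: funext => M; rewrite rder_gen_inv.
  rewrite trunc_evalZ /= mulr0 addr0 eq_sym.
  have := trunc_eval_letter q.+1 (x, true) series_one.
  rewrite trunc_eval1 series_mulr1 mulr1 /wval big_seq1 /=.
  move=> ae; rewrite bool_mul_diff -[X in adic X]addn0.
  apply: adicM (adic_bool _); by rewrite -opprB; apply: adicN.
rewrite -[q.+1]add0n; apply: adicM IH; rewrite /w /wval big_seq1.
by case: ifP => _; [apply: adic_abel2V | apply: adic_abel2].
Qed.

Lemma adic_fox q u : weqmod q.+1 u [::] -> adic q.+1 (fox abel2 false u).
Proof.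
move=> u1; have := fox_trunc_eval q u; rewrite trunc_eval0 ?subr0 // => M Mq.
rewrite -(rder_one false M); apply: u1; by rewrite size_rcons.
Qed.

(** * The Alexander matrix *)

Lemma adic_sum (I : finType) q (F : I -> ratfun2) :
  (forall i, adic q (F i)) -> adic q (\sum_i F i).
Proof.
move=> aF; elim/big_ind: _ => //; [exact: adic0 | by move=> *; apply: adicD].
Qed.

Lemma adic_sign k : adic 0 ((-1) ^+ k).
Proof.
elim: k => [|k IH]; first exact: (adic_int 1).
by rewrite exprS mulN1r; apply: adicN.
Qed.

Lemma adic_det m (A : 'M[ratfun2]_m) :
  (forall i j, adic 0 (A i j)) -> adic 0 (\det A).
Proof.
move=> aA; apply: adic_sum => s; rewrite -[0%N]addn0; apply: adicM.
  exact: adic_sign.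
elim/big_ind: _ => //; first exact: (adic_int 1).
by move=> y z; rewrite -[0%N]addn0; apply: adicM.
Qed.

Lemma adic_fox0 (I : eqType) (h : I -> ratfun2) x u :
  (forall y, adic 0 (h y)) -> (forall y, adic 0 (h y)^-1) -> adic 0 (fox h x u).
Proof.
move=> ah ahV; have aM (y z : ratfun2) : adic 0 y -> adic 0 z -> adic 0 (y * z).
  by rewrite -[0%N]addn0; apply: adicM.
elim: u => [|[y b] u IH] /=; first exact: adic0.

have an := adic_bool (y == x).
case: b; apply: adicD; [exact: adicN (aM _ _ an (ahV y)) | exact: aM _ _ (ahV y) IH
  | exact: an | exact: aM _ _ (ah y) IH].
Qed.

(** The adjugate gives det A * z = adj A * (A z).  The vector z may vary with q:
    no limit has to be taken, as its entry at i0 is always 1. *)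
Lemma det_eq0_of_adic m (A : 'M[ratfun2]_m) (i0 : 'I_m) :
  (forall i j, adic 0 (A i j)) ->
  (forall q, exists2 z : 'cV_m, z i0 0 = 1 & forall i, adic q ((A *m z) i 0)) ->
  \det A = 0.
Proof.
move=> aA Az; apply: adic_eq0 => q; have [z z1 aAz] := Az q.
have -> : \det A = (\adj A *m (A *m z)) i0 0.
  by rewrite mulmxA mul_adj_mx mul_scalar_mx mxE z1 mulr1.
rewrite mxE; apply: adic_sum => j; rewrite -[q]add0n; apply: adicM => //.
rewrite mxE /cofactor -[0%N]addn0; apply: adicM.
  exact: adic_sign.
by apply: adic_det => k l; rewrite !mxE.
Qed.

Lemma mul_conj_div (K : fieldType) (w a : K) :
  a != 0 -> w != 0 -> w^-1 * (a * (w * a^-1)) = 1.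
Proof. by move=> a0 w0; rewrite [a * _]mulrCA mulfV // mulr1 mulVf. Qed.

Section AlexanderMatrix.
Variables (R : realType) (D : vknot_diagram R).
Local Notation n := (npass D).
Local Notation ab := (@abelianize n).

Lemma ab_neq0 x : ab x != 0.
Proof. by case: x => [j|]; [apply: (abel2_neq0 false) | apply: (abel2_neq0 true)]. Qed.

Lemma wval_relator i : wval ab (relator D i) = 1.
Proof.
rewrite /relator !wval_cat !wval_winv !wval_gen /=.
apply: mul_conj_div; first exact: (abel2_neq0 false).
exact: (wval_neq0 _ ab_neq0).
Qed.

Lemma sum_option (T : finType) (F : option T -> ratfun2) :
  \sum_x F x = F None + \sum_j F (Some j).
Proof.
rewrite (bigD1 None) //=; congr (_ + _).
rewrite (reindex_omap (op := +%R) Some id) => [|[]] //.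
by apply: eq_bigl => j; rewrite eqxx.
Qed.

(** The images of the arcs are conjugates of a, hence the chain rule for phi^(q)
    involves the very entries of the Alexander matrix. *)
Lemma wval_phi_gen q x : wval abel2 (phi_gen D q x) = ab x.
Proof.
case: x => [j|]; last by rewrite phi_gen_v wval_gen.
case: q => [|[|q]]; rewrite ?wval_gen //.
rewrite phi_gen_arc !wval_cat wval_winv wval_gen mulrCA mulVf ?mulr1 //.
exact: wval_neq0 abel2_neq0.
Qed.

Lemma relator_chain_rule q i :
  \sum_(j : 'I_(narcs n)) fox ab (Some j) (relator D i)
     * fox abel2 false (phi_gen D q (Some j))
  = fox abel2 false (wsubst (phi_gen D q) (relator D i)).
Proof.
rewrite (fox_wsubst _ _ _ abel2_neq0).
rewrite [RHS](eq_bigr (fun x => fox ab x (relator D i)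
                                * fox abel2 false (phi_gen D q x))); last first.
  by move=> x _; congr (_ * _); apply: eq_fox => y; apply: wval_phi_gen.
(* v is mapped to v, whose derivative with respect to a is 0. *)
by rewrite sum_option phi_gen_v /= mulr0 addr0 mulr0 add0r.
Qed.

Definition arc_minor (f : 'I_(narcs n) -> 'I_n) : 'M[ratfun2]_(narcs n) :=
  \matrix_(i, j) fox ab (Some j) (relator D (f i)).

Lemma arc_minor_eq0 (f : 'I_(narcs n) -> 'I_n) :
  (forall J, J != [::] -> zh D J = 0) -> \det (arc_minor f) = 0.
Proof.
move=> zh0; apply: (@det_eq0_of_adic _ _ ord0) => [i j|q].
  rewrite mxE; apply: adic_fox0 => -[k|].
  - exact: (adic_abel2 false).
  - exact: (adic_abel2 true).
  - exact: (adic_abel2V false).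
  - exact: (adic_abel2V true).
exists (\col_j fox abel2 false (phi_gen D q.+2 (Some j))) => [|i].
  by rewrite mxE phi_gen_arc0 /= mulr0 addr0.
rewrite mxE; apply: (@adic_le q.+1) => //.
rewrite (eq_bigr (fun j => fox ab (Some j) (relator D (f i))
           * fox abel2 false (phi_gen D q.+2 (Some j)))); last first.
  by move=> j _; rewrite !mxE.
rewrite relator_chain_rule; apply: adic_fox; exact: weqmod_relator.
Qed.

(** Relators abelianize to 1, so the fundamental formula is a linear relation
    between the columns with coefficients t - 1 and v - 1. *)
Lemma fox_v_relator i :
  fox ab None (relator D i) =
  \sum_j fox ab (Some j) (relator D i) * - ((t_ - 1) / (v_ - 1)).
Proof.
have v1 : v_ - 1 != 0.
  rewrite subr_eq0 -tofrac1 tofrac_eq -[1]/(1%:P); apply/eqP => /polyC_inj.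
  by move/(congr1 (fun p : {poly int} => size p)); rewrite size_polyX size_poly1.
have := fox_fundamental (relator D i) ab_neq0.
rewrite sum_option wval_relator subrr => /eqP.
rewrite addr_eq0 => /eqP e; apply: (mulIf v1); rewrite e.
rewrite mulr_suml -sumrN; apply: eq_bigr => j _.
by rewrite mulrN mulNr -mulrA divfK.
Qed.

Lemma all_minors_eq0 x : (forall J, J != [::] -> zh D J = 0) ->
  is_minor (narcs n) (alexander_matrix D) x -> x = 0.
Proof.
move=> zh0 [f [g [_ _ ->]]].
(* C expresses all the columns through those of the short arcs. *)
pose C : 'M[ratfun2]_(narcs n, (narcs n).+1) :=
  \matrix_(j, k) if unlift ord_max k is Some j' then (j == j')%:R
                 else - ((t_ - 1) / (v_ - 1)).
suff -> : mxsub f g (alexander_matrix D) = arc_minor f *m colsub g C.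
  by rewrite det_mulmx arc_minor_eq0 // mul0r.
apply/matrixP => i k; rewrite !mxE.
case: (unliftP ord_max (g k)) => [j|] gk.
  rewrite (bigD1 j) //= big1 => [|j' /negPf jj']; rewrite !mxE gk liftK.
    by rewrite eqxx mulr1 addr0.
  by rewrite jj' mulr0.
rewrite fox_v_relator; apply: eq_bigr => j _.
by rewrite !mxE gk unlift_none.
Qed.
End AlexanderMatrix.

Theorem theorem6p1p2 (R : realType) (K : vknot_diagram R)
    (zh_vanish : forall J : seq bool, J != [::] -> zh K J = 0) :
  generalized_alexander_polynomial K 0.
Proof.
have laurent0 : laurent 0 by exists 0, 0%N, 0%N; rewrite tofrac0 mul0r.
split=> // [x minor_x|e _ _]; exists 0; rewrite ?mul0r //.
exact: all_minors_eq0 minor_x.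
Qed.
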